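(* Let $\mathcal{T}$ be an edge cutting pattern of the cube $\mathcal{C}$ that produces an unfolding of the cube. Then $\mathcal{T}$ is a spanning tree of the graph formed by the vertices and edges of $\mathcal{C}$.
   Context: Let $\mathcal{C}\subset\mathbb{R}^3$ be the surface of a cube; $\mathcal{C}$ also denotes the graph formed by its 8 vertices and 12 edges. A spanning tree of a graph is a subgraph that contains all vertices of the graph, has no circuits, and is connected. A finite collection of squares in the plane (all congruent to the faces of $\mathcal{C}$) is said to be joined along edges if any two distinct squares of the collection are disjoint, or meet in a single common corner, or meet precisely in a full edge of both squares. Such a collection is called connected if any two of its squares are linked by a chain of squares of the collection in which consecutive squares share an edge, and the boundary (in the plane) of the union of the squares has a single connected component. An unfolding of the cube is a connected planar arrangement $U$ of six squares, joined along edges, which folds up into the cube: there is a continuous map $f$ (a folding map) from the union of the squares onto $\mathcal{C}$ that restricts to an isometry of each square of $U$ onto a face of $\mathcal{C}$, with the six squares going to the six distinct faces. The edge cutting pattern that produces the unfolding (with folding map $f$) is the subgraph $\mathcal{T}$ of the cube graph consisting of the edges of the cube along which the surface is cut, together with their endpoints; equivalently, $\mathcal{T}$ is the image under $f$ of the boundary of $U$. *)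

(* Defs.v *)
From HB Require Import structures.
From mathcomp Require Import all_boot all_order all_algebra.
From mathcomp Require Import all_classical all_reals all_analysis.

Set Implicit Arguments.
Unset Strict Implicit.
Unset Printing Implicit Defensive.

Import Order.TTheory GRing.Theory Num.Theory.
Import numFieldNormedType.Exports.

Local Open Scope classical_set_scope.
Local Open Scope ring_scope.

(* The library norm on row vectors is the sup norm, so the Euclidean structure
   is introduced explicitly; the topology of 'rV[R]_n is the usual one. *)
Definition dot (R : realType) (n : nat) (x y : 'rV[R]_n) : R :=
  \sum_(i < n) x 0 i * y 0 i.

Definition edist (R : realType) (n : nat) (x y : 'rV[R]_n) : R :=
  Num.sqrt (dot (x - y) (x - y)).

Definition segment (R : realType) (n : nat) (x y : 'rV[R]_n) : set 'rV[R]_n :=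
  [set p | exists2 t : R, 0 <= t <= 1 & p = x + t *: (y - x)].

Definition boundary (T : topologicalType) (A : set T) : set T :=
  closure A `\` interior A.

(* Literally: the set of connected components of A is a singleton, so A is
   in particular nonempty. *)
Definition single_component (T : topologicalType) (A : set T) : Prop :=
  exists C : set T, connected_component A @` A = [set C].

Definition square_frame (R : realType) (a : R) (u v : 'rV[R]_2) : Prop :=
  [/\ dot u u = a ^+ 2, dot v v = a ^+ 2 & dot u v = 0].

Definition square_at (R : realType) (o u v : 'rV[R]_2) : set 'rV[R]_2 :=
  [set p | exists s t : R,
     [/\ 0 <= s <= 1, 0 <= t <= 1 & p = o + s *: u + t *: v]].

Definition is_square (R : realType) (a : R) (S : set 'rV[R]_2) : Prop :=
  exists o u v, square_frame a u v /\ S = square_at o u v.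

(* Every corner of a square is the origin of some frame of it, and every edge
   is the first side of some frame. *)
Definition is_corner (R : realType) (a : R) (S : set 'rV[R]_2)
    (p : 'rV[R]_2) : Prop :=
  exists u v, square_frame a u v /\ S = square_at p u v.

Definition is_edge (R : realType) (a : R) (S A : set 'rV[R]_2) : Prop :=
  exists o u v,
    [/\ square_frame a u v, S = square_at o u v & A = segment o (o + u)].

Definition meet_in_corner (R : realType) (a : R) (S S' : set 'rV[R]_2) : Prop :=
  exists p, [/\ is_corner a S p, is_corner a S' p & S `&` S' = [set p]].

Definition meet_in_edge (R : realType) (a : R) (S S' : set 'rV[R]_2) : Prop :=
  exists A, [/\ is_edge a S A, is_edge a S' A & S `&` S' = A].

Definition joined_along_edges (R : realType) (a : R) (m : nat)
    (Q : 'I_m -> set 'rV[R]_2) : Prop :=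
  forall i j, i != j ->
    [\/ Q i `&` Q j = set0, meet_in_corner a (Q i) (Q j)
      | meet_in_edge a (Q i) (Q j)].

Definition arrangement_union (R : realType) (m : nat)
    (Q : 'I_m -> set 'rV[R]_2) : set 'rV[R]_2 :=
  \bigcup_(i in [set: 'I_m]) Q i.

Definition chain_connected (R : realType) (a : R) (m : nat)
    (Q : 'I_m -> set 'rV[R]_2) : Prop :=
  forall i j, connect (fun k l => `[< meet_in_edge a (Q k) (Q l) >]) i j.

Definition connected_arrangement (R : realType) (a : R) (m : nat)
    (Q : 'I_m -> set 'rV[R]_2) : Prop :=
  chain_connected a Q /\ single_component (boundary (arrangement_union Q)).

(* A cube of arbitrary size and position: the rows of cube_axes are its three
   edge vectors at the vertex cube_origin. *)

Record cube (R : realType) := Cube {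
  cube_origin : 'rV[R]_3;
  cube_axes : 'M[R]_3;
  cube_side : R;
  cube_side_gt0 : 0 < cube_side;
  cube_axes_orthogonal : cube_axes *m cube_axes^T = (cube_side ^+ 2)%:M }.

Definition cube_point (R : realType) (K : cube R) (x : 'rV[R]_3) : 'rV[R]_3 :=
  cube_origin K + x *m cube_axes K.

Definition cube_face (R : realType) (K : cube R) (F : 'I_3 * bool) :
    set 'rV[R]_3 :=
  [set p | exists x : 'rV[R]_3,
     [/\ forall i, 0 <= x 0 i <= 1, x 0 F.1 = F.2%:R & p = cube_point K x]].

Definition cube_surface (R : realType) (K : cube R) : set 'rV[R]_3 :=
  \bigcup_(F in [set: 'I_3 * bool]) cube_face K F.

(* Vertices of the cube graph are 0/1-vectors in cube coordinates. *)
Definition cube_vertex : finType := {ffun 'I_3 -> bool}.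

Definition cube_adj : rel cube_vertex :=
  fun x y => #|[set i | x i != y i]%SET| == 1%N.

Definition vertex_pos (R : realType) (K : cube R) (x : cube_vertex) :
    'rV[R]_3 :=
  cube_point K (\row_i (x i)%:R).

Definition graph_edges (V : finType) (e : rel V) : {set {set V}} :=
  [set A | [exists x, exists y, e x y && (A == [set x; y])]]%SET.

Definition edge_segment (R : realType) (K : cube R) (A : {set cube_vertex}) :
    set 'rV[R]_3 :=
  [set p | exists x y,
     A = [set x; y]%SET /\ segment (vertex_pos K x) (vertex_pos K y) p].

(* Edges are 2-element sets of vertices. *)

Record subgraph (V : finType) (e : rel V) := Subgraph {
  sg_vertices : {set V};
  sg_edges : {set {set V}};
  sg_edges_sub : sg_edges \subset graph_edges e;
  sg_endpoints : forall A, A \in sg_edges -> A \subset sg_vertices }.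

Definition sg_adj (V : finType) (e : rel V) (T : subgraph e) : rel V :=
  fun x y => [set x; y]%SET \in sg_edges T.

Definition sg_connected (V : finType) (e : rel V) (T : subgraph e) : Prop :=
  {in sg_vertices T &, forall x y, connect (sg_adj T) x y}.

(* In a simple graph a circuit has at least three vertices. *)
Definition has_circuit (V : finType) (e : rel V) (T : subgraph e) : Prop :=
  exists c : seq V, (2 < size c)%N /\ ucycle (sg_adj T) c.

Definition spanning_tree (V : finType) (e : rel V) (T : subgraph e) : Prop :=
  [/\ sg_vertices T = [set: V]%SET, ~ has_circuit T & sg_connected T].

(* Only the values of f on the union of the squares matter. *)
Record folding_map (R : realType) (K : cube R) (m : nat)
    (Q : 'I_m -> set 'rV[R]_2) (f : 'rV[R]_2 -> 'rV[R]_3) : Prop := FoldingMap {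
  fold_continuous : {within arrangement_union Q, continuous f};
  fold_onto : f @` arrangement_union Q = cube_surface K;
  fold_isometry : forall i x y, Q i x -> Q i y -> edist (f x) (f y) = edist x y;
  fold_face : forall i, exists F, f @` Q i = cube_face K F;
  fold_distinct : forall i j, i != j -> f @` Q i <> f @` Q j }.

Record unfolding (R : realType) (K : cube R) (Q : 'I_6 -> set 'rV[R]_2)
    (f : 'rV[R]_2 -> 'rV[R]_3) : Prop := Unfolding {
  unf_square : forall i, is_square (cube_side K) (Q i);
  unf_distinct : injective Q;
  unf_joined : joined_along_edges (cube_side K) Q;
  unf_connected : connected_arrangement (cube_side K) Q;
  unf_folds : folding_map K Q f }.

(* The surface is cut along exactly those edges of the cube that are covered
   by the image of the boundary of the planar arrangement. *)
Record edge_cutting_pattern (R : realType) (K : cube R)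
    (Q : 'I_6 -> set 'rV[R]_2) (f : 'rV[R]_2 -> 'rV[R]_3)
    (T : subgraph cube_adj) : Prop := EdgeCuttingPattern {
  cut_edges : forall A,
    A \in sg_edges T <->
    A \in graph_edges cube_adj /\
    edge_segment K A `<=` f @` boundary (arrangement_union Q);
  cut_vertices : forall x,
    x \in sg_vertices T <-> exists2 A, A \in sg_edges T & x \in A }.

(* Main.v *)
Require Import Defs.
From HB Require Import structures.
From mathcomp Require Import all_boot all_order all_algebra.
From mathcomp Require Import all_classical all_reals all_analysis.
From mathcomp Require Import ring lra.

Set Implicit Arguments.
Unset Strict Implicit.
Unset Printing Implicit Defensive.

Import Order.TTheory GRing.Theory Num.Theory.
Import numFieldNormedType.Exports.

Local Open Scope classical_set_scope.
Local Open Scope ring_scope.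

(** The cut edges form a spanning tree because of Euler duality between the cube
graph (8 vertices, 12 edges) and its dual (6 faces, the same 12 edges).  Each
edge of the cube is either cut, or glued: the two planar squares that carry the
faces along it share in the plane the side that folds onto it.

The geometric part is to establish this alternative.  An isometry between two
unit squares is affine, so around each vertex of the cube each square of the net
is described by a corner and two orthogonal arms ([fold_corner],
[square_corner]).  Two squares glued along a side lie on opposite sides of it
([glued_opposite]), so the inner points of the side are interior to the net and
the edge is not in the image of the boundary; if the squares are not glued, then
near such a point the net is a single square, and the whole edge is in the image
of the boundary.  This is [cut_not_glued].

Three facts then give the theorem.
- Each vertex of the cube lies on a cut edge ([vertex_cut]).  Otherwise the three
  squares at the vertex would be glued in a cycle around one point of the plane;
  but three right angles do not close up ([no_three_glued]).
- The cut edges form a connected graph ([cut_connected]): their union is the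
  image of the boundary of the net, which is connected because the boundary is.
- At most seven edges are cut ([cut_edges_bound]): the squares are linked by
  chains of glued edges, so the dual graph on six faces is connected by uncut
  edges, and at least five edges are uncut.

A connected graph on eight vertices needs at least seven edges
([connected_leq_card_edges]), so no edge of the cut graph can be spared, whereas
every edge of a circuit could be ([tight_connected_acyclic]). *)

(** * Connected graphs with few edges *)

(** A vertex set that contains [x0] and spans at least as many edges as it has
further vertices can grow along any edge that leaves it; by connectedness a
maximal such set is everything. *)
Lemma connected_leq_card_edges (V : finType) (E : {set {set V}}) :
  (forall x y, connect (fun x y => [set x; y]%SET \in E) x y) ->
  (#|V| <= #|E|.+1)%N.
Proof.
move=> conE.
have [->//|/card_gt0P[x0 _]] := posnP #|V|.
pose inside (S : {set V}) := [set A in E | A \subset S]%SET.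
pose grown (S : {set V}) := (x0 \in S) && (#|S| <= #|inside S|.+1)%N.
have : exists S, grown S.
  by exists [set x0]%SET; rewrite /grown finset.set11 cards1.
case/ex_maxset=> S /maxsetP[/andP[x0S leS] maxS].
have cl x y : [set x; y]%SET \in E -> x \in S -> y \in S.
  move=> xyE xS; apply/negPn/negP => yS.
  have grow : grown (y |: S)%SET.
    rewrite /grown inE x0S orbT cardsU1 yS ltnS.
    suff : (#|[set x; y] |: inside S| <= #|inside (y |: S)|)%SET%N.
      rewrite cardsU1; apply: leq_trans.
      by rewrite inE xyE /= finset.subUset !finset.sub1set (negPf yS) andbF.
    apply/subset_leq_card/fintype.subsetP => A; rewrite !inE.
    case/orP=> [/eqP->|/andP[-> AS]].
      by rewrite xyE finset.subUset !finset.sub1set !inE xS eqxx orbT.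
    exact: fintype.subset_trans AS (finset.subsetUr _ _).
  by move: yS; rewrite -(maxS _ grow (finset.subsetUr _ _)) !inE eqxx.
have SV y : y \in S.
  rewrite -(@closed_connect _ (fun x y => [set x; y]%SET \in E) (mem S) _ x0 y)
    //.
  move=> x z xz; apply/idP/idP; first exact: cl.
  by apply: cl; rewrite finset.setUC.
rewrite -cardsT; apply: leq_trans (subset_leq_card (finset.subsetT _)) _.
have -> : [set: V]%SET = S by apply/setP=> y; rewrite SV inE.
apply: leq_trans leS _; rewrite ltnS.
by apply/subset_leq_card/fintype.subsetP => A; rewrite inE => /andP[].
Qed.

(** The rest of a circuit is a detour around its first edge. *)
Lemma circuit_edge_redundant (V : finType) (E : {set {set V}}) (x y : V)
    (c : seq V) :
  ucycle (fun u v => [set u; v]%SET \in E) [:: x, y & c] -> c != [::] ->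
  connect (fun u v => [set u; v] \in E :\ [set x; y])%SET y x.
Proof.
case: c => // z c /andP[/= /andP[_ cyc] /and3P[xNc yNc _]] _.
apply/connectP; exists (rcons (z :: c) x); last by rewrite last_rcons.
have yx : y != x by apply: contraNneq xNc => <-; rewrite inE eqxx.
have {}xNc : x \notin z :: c by move: xNc; rewrite inE => /norP[].
case/andP: cyc => yzE /= pth.
have zE u v : u != x -> v != x -> [set u; v]%SET != [set x; y]%SET.
  move=> ux vx; apply/eqP => /setP/(_ x); rewrite !inE eqxx.
  by rewrite ![x == _]eq_sym (negPf ux) (negPf vx).
have xz : z != x by move: xNc; rewrite inE eq_sym => /norP[].
rewrite !inE yzE zE //=.
move: pth yNc; clear yzE; elim: c z xNc xz => [|t c IH] z xNc xz /=.
  rewrite !andbT => zx; rewrite !inE eq_sym => yz; rewrite zx andbT.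
  apply/eqP => /setP/(_ y); rewrite !inE eqxx orbT.
  by rewrite eq_sym (negPf yz) (negPf yx).
case/andP=> ztE tpth yNc.
have xt : t != x by apply: contraNneq xNc => ->; rewrite !inE eqxx orbT.
rewrite !inE ztE zE //=; apply: IH => //.
  by move: xNc; rewrite inE => /norP[].
by move: yNc; rewrite inE => /norP[].
Qed.

(** Deleting an edge of a circuit would keep the graph connected, with too few
edges for that. *)
Lemma tight_connected_acyclic (V : finType) (e : rel V) (T : subgraph e) :
  sg_vertices T = [set: V]%SET -> sg_connected T ->
  (#|sg_edges T| < #|V|)%N -> ~ has_circuit T.
Proof.
move=> VT conT ltTV [[|x [|y c]] [sz cyc]] //.
have redxy : connect
    (fun u v => [set u; v] \in sg_edges T :\ [set x; y])%SET y x.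
  by apply: circuit_edge_redundant cyc _; case: c sz.
have xyT : [set x; y]%SET \in sg_edges T by case/andP: cyc => /andP[].
suff : (#|V| <= #|sg_edges T :\ [set x; y]|.+1)%SET%N.
  move: ltTV; rewrite (cardsD1 [set x; y]%SET (sg_edges T)) xyT.
  by rewrite ltnNge => /negP.
apply: connected_leq_card_edges => u v.
have : connect (sg_adj T) u v by apply: conT; rewrite VT inE.
apply: connect_sub => {}u {}v; rewrite /sg_adj => uvT.
have [uvxy|uvxy] := eqVneq [set u; v]%SET [set x; y]%SET; last first.
  by apply: connect1; rewrite !inE uvT uvxy.
have csym : connect_sym
    (fun u v => [set u; v] \in sg_edges T :\ [set x; y])%SET.
  by apply: sym_connect_sym => s t /=; rewrite finset.setUC.
have : u \in [set x; y]%SET by rewrite -uvxy !inE eqxx.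
have : v \in [set x; y]%SET by rewrite -uvxy !inE eqxx orbT.
by rewrite !inE => /orP[]/eqP-> /orP[]/eqP-> //; rewrite csym.
Qed.

(** * The graph of the cube *)

Definition flip (x : cube_vertex) (k : 'I_3) : cube_vertex :=
  [ffun i => x i (+) (i == k)].

Lemma flip_at x k : flip x k k = ~~ x k.
Proof. by rewrite ffunE eqxx addbT. Qed.

Lemma flip_off x k i : i != k -> flip x k i = x i.
Proof. by move=> ik; rewrite ffunE (negPf ik) addbF. Qed.

Lemma flipK k : involutive (flip^~ k).
Proof. by move=> x; apply/ffunP=> i; rewrite !ffunE -addbA addbb addbF. Qed.

Lemma flip_neq x k : flip x k != x.
Proof. by apply/eqP => /ffunP/(_ k); rewrite flip_at; case: (x k). Qed.

Lemma cube_adj_flip x k : cube_adj x (flip x k).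
Proof.
apply/cards1P; exists k; apply/setP => i; rewrite !inE ffunE.
by case: (x i); case: (i == k).
Qed.

Lemma cube_adjP x y : cube_adj x y -> exists k, y = flip x k.
Proof.
move=> /cards1P[k /setP xyk]; exists k; apply/ffunP => i.
by have := xyk i; rewrite !inE ffunE => <-; case: (x i); case: (y i).
Qed.

Lemma flip_edge x k : [set x; flip x k]%SET \in graph_edges cube_adj.
Proof.
by rewrite inE; apply/existsP; exists x; apply/existsP; exists (flip x k);
  rewrite cube_adj_flip eqxx.
Qed.

Lemma cube_edgeP A : A \in graph_edges cube_adj ->
  exists x k, A = [set x; flip x k]%SET.
Proof.
rewrite inE => /existsP[x /existsP[y /andP[/cube_adjP[k ->] /eqP->]]].
by exists x, k.
Qed.

Lemma ord3_ind (P : 'I_3 -> Prop) :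
  P 0%R -> P 1%R -> P 2%:R -> forall i, P i.
Proof.
move=> P0 P1 P2; case=> [[|[|[|//]]] i3].
- by rewrite (_ : Ordinal i3 = 0)//; apply: val_inj.
- by rewrite (_ : Ordinal i3 = 1)//; apply: val_inj.
- by rewrite (_ : Ordinal i3 = 2%:R)//; apply: val_inj.
Qed.

Lemma ord3_third (j l : 'I_3) : exists k : 'I_3, (k != j) && (k != l).
Proof.
by elim/ord3_ind: j; elim/ord3_ind: l;
  solve [exists 0 => // | exists 1 => // | exists 2%:R => //].
Qed.

Lemma ord3_cover (j k l : 'I_3) : k != j -> l != j -> l != k ->
  forall i, [|| i == j, i == k | i == l].
Proof.
by elim/ord3_ind: j; elim/ord3_ind: k => // _; elim/ord3_ind: l => // _ _;
  elim/ord3_ind.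
Qed.

(** An edge is determined by its direction and its two fixed coordinates, which
makes at most [3 * 2 * 2] of them. *)
Lemma card_cube_edges : (#|graph_edges cube_adj| <= 12)%N.
Proof.
pose vtx (k : 'I_3) b c : cube_vertex :=
  [ffun i => if i == k then false else if i == (k + 1)%R then b else c].
pose edge (p : 'I_3 * bool * bool) : {set cube_vertex} :=
  let v := vtx p.1.1 p.1.2 p.2 in [set v; flip v p.1.1]%SET.
have -> : 12%N = #|[set: 'I_3 * bool * bool]%SET|.
  by rewrite cardsT !card_prod card_ord card_bool.
apply: leq_trans (leq_imset_card edge _).
apply/subset_leq_card/fintype.subsetP => A /cube_edgeP[x [k ->]].
apply/imsetP.
wlog xk : x / x k = false.
  move=> H; have [xk|/negbTE xk] := boolP (x k); last exact: H.
  have [|p _ e] := H (flip x k); first by rewrite flip_at xk.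
  by exists p; rewrite // -e flipK finset.setUC.
exists (k, x (k + 1)%R, x (k + 2%:R)%R) => //; rewrite /edge /=.
suff -> : vtx k (x (k + 1)%R) (x (k + 2%:R)%R) = x by [].
apply/ffunP => i; rewrite ffunE; have [->//|ik] := eqVneq i k.
have [->//|ik1] := eqVneq i (k + 1).
congr (x _); move: ik ik1; clear.
by elim/ord3_ind: k; elim/ord3_ind: i => // _ _; apply: val_inj.
Qed.

(** * Frames and squares in the plane *)

Section Dot.
Variables (R : realType) (n : nat).
Implicit Types (x y z : 'rV[R]_n) (c : R).

Lemma dotC x y : dot x y = dot y x.
Proof. by apply: eq_bigr => i _; rewrite mulrC. Qed.

Lemma dotDl x y z : dot (x + y) z = dot x z + dot y z.
Proof. by rewrite -big_split; apply: eq_bigr => i _; rewrite mxE mulrDl. Qed.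

Lemma dotNl x z : dot (- x) z = - dot x z.
Proof. by rewrite -sumrN; apply: eq_bigr => i _; rewrite mxE mulNr. Qed.

Lemma dotZl c x z : dot (c *: x) z = c * dot x z.
Proof. by rewrite mulr_sumr; apply: eq_bigr => i _; rewrite mxE mulrA. Qed.

Lemma dotDr x y z : dot z (x + y) = dot z x + dot z y.
Proof. by rewrite dotC dotDl ![dot z _]dotC. Qed.

Lemma dotNr x z : dot z (- x) = - dot z x.
Proof. by rewrite dotC dotNl dotC. Qed.

Lemma dotZr c x z : dot z (c *: x) = c * dot z x.
Proof. by rewrite dotC dotZl dotC. Qed.

(** Rewriting with these rules also unfolds vectors that are defined as
differences; the proofs below generalize such vectors first. *)
Definition dotE := (dotDl, dotDr, dotNl, dotNr, dotZl, dotZr).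

Lemma dot_ge0 x : 0 <= dot x x.
Proof. by apply: sumr_ge0 => i _; rewrite -expr2 sqr_ge0. Qed.

Lemma dot_eq0 x : dot x x = 0 -> x = 0.
Proof.
move=> /eqP; rewrite psumr_eq0 => [/allP x0|i _]; last first.
  by rewrite -expr2 sqr_ge0.
apply/rowP => i; rewrite mxE; apply/eqP.
by have := x0 i (mem_index_enum i); rewrite mulf_eq0 orbb.
Qed.

End Dot.

Lemma edist_eq (R : realType) (m n : nat) (x y : 'rV[R]_m)
    (x' y' : 'rV[R]_n) :
  Defs.edist x y = Defs.edist x' y' ->
  dot (x - y) (x - y) = dot (x' - y') (x' - y').
Proof. by move=> /eqP; rewrite eqr_sqrt ?dot_ge0// => /eqP. Qed.

(** The three distances determine the inner products of [q - p] with [u] and [v],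
and then the distance from [q] to [p + s *: u + t *: v] is computed to be zero.
This is why a distance-preserving map of a square is affine. *)
Lemma frame_trilateration (R : realType) (n : nat) (a s t : R)
    (p u v q : 'rV[R]_n) :
  dot u u = a ^+ 2 -> dot v v = a ^+ 2 -> dot u v = 0 ->
  dot (q - p) (q - p) = a ^+ 2 * (s ^+ 2 + t ^+ 2) ->
  dot (q - (p + u)) (q - (p + u)) = a ^+ 2 * ((1 - s) ^+ 2 + t ^+ 2) ->
  dot (q - (p + v)) (q - (p + v)) = a ^+ 2 * (s ^+ 2 + (1 - t) ^+ 2) ->
  q = p + s *: u + t *: v.
Proof.
move=> uu vv uv qp qu qv.
have [d qd] : exists d, q = p + d by exists (q - p); rewrite addrC subrK.
have dd : dot d d = a ^+ 2 * (s ^+ 2 + t ^+ 2) by rewrite -qp qd addrC addKr.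
have du : dot d u = a ^+ 2 * s.
  move: qu; rewrite qd opprD addrA [p + d]addrC addrK !dotE uu dd (dotC u d).
  lra.
have dv : dot d v = a ^+ 2 * t.
  move: qv; rewrite qd opprD addrA [p + d]addrC addrK !dotE vv dd (dotC v d).
  lra.
rewrite qd -addrA; congr (_ + _); apply/eqP; rewrite -subr_eq0; apply/eqP.
apply: dot_eq0; rewrite opprD addrA !dotE dd (dotC u d) (dotC v d) (dotC v u).
rewrite du dv uu vv uv; ring.
Qed.

Section Plane.
Variables (R : realType) (a : R).
Hypothesis a0 : 0 < a.
Implicit Types p q u v : 'rV[R]_2.

Lemma dot2 (u v : 'rV[R]_2) : dot u v = u 0 0 * v 0 0 + u 0 1 * v 0 1.
Proof.
rewrite /dot !big_ord_recl big_ord0 addr0.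
by have -> : lift ord0 ord0 = 1 :> 'I_2 by apply: val_inj.
Qed.

(** This is where dimension two enters: a matrix with orthonormal rows also has
orthonormal columns.  [v0], [v1] and [w] below are the column relations. *)
Lemma plane_frame u v d : square_frame a u v ->
  d = (dot d u / a ^+ 2) *: u + (dot d v / a ^+ 2) *: v.
Proof.
rewrite /square_frame !dot2 => -[uu vv uv].
have a20 : a ^+ 2 != 0 by rewrite sqrf_eq0 gt_eqF.
have v0 : v 0 0 ^+ 2 = u 0 1 ^+ 2.
  apply: (mulfI a20); rewrite -{1}uu -vv.
  apply/eqP; rewrite -subr_eq0; apply/eqP.
  have -> : forall x y z w : R, (x * x + y * y) * z ^+ 2 -
      (z * z + w * w) * y ^+ 2 = (x * z + y * w) * (x * z - y * w).
    by move=> *; ring.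
  by rewrite uv mul0r.
have v1 : v 0 1 ^+ 2 = u 0 0 ^+ 2 by lra.
have w : u 0 0 * u 0 1 + v 0 0 * v 0 1 = 0.
  apply: (mulfI a20); rewrite mulr0 mulrDr -{1}vv -uu.
  have -> : forall x y z w : R, (z * z + w * w) * (x * y) +
      (x * x + y * y) * (z * w) = (x * z + y * w) * (y * z + x * w).
    by move=> *; ring.
  by rewrite uv mul0r.
suff E : a ^+ 2 *: d = dot d u *: u + dot d v *: v.
  apply: (scalerI a20); rewrite E scalerDr !scalerA.
  by rewrite ![a ^+ 2 * _]mulrC !divfK// -!dot2.
apply/rowP => i; rewrite !mxE !dot2.
have [->|->] : i = 0 \/ i = 1.
  by case: i => [[|[|//]]] ?; [left|right]; apply: val_inj.
- transitivity (d 0 0 * (u 0 0 ^+ 2 + v 0 0 ^+ 2) +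
    d 0 1 * (u 0 0 * u 0 1 + v 0 0 * v 0 1)); last by ring.
  by rewrite w v0 -uu; ring.
- transitivity (d 0 1 * (u 0 1 ^+ 2 + v 0 1 ^+ 2) +
    d 0 0 * (u 0 0 * u 0 1 + v 0 0 * v 0 1)); last by ring.
  by rewrite w v1 -uu; ring.
Qed.

(** Hence two squares with a common side coincide or lie opposite to each
other. *)
Lemma orthogonal_pm u v v' : square_frame a u v -> square_frame a u v' ->
  v' = v \/ v' = - v.
Proof.
move=> fuv [uu vv' uv']; have [_ vv uv] := fuv.
have a20 : a ^+ 2 != 0 by rewrite sqrf_eq0 gt_eqF.
have := plane_frame v' fuv; rewrite (dotC v' u) uv' mul0r scale0r add0r => v'E.
move: vv'; rewrite v'E !dotE vv; set c := _ / _ => cc.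
have : c ^+ 2 == 1 by apply/eqP/(mulIf a20); rewrite -[LHS]mulrA mul1r.
by rewrite sqrf_eq1 => /orP[]/eqP->; [left|right]; rewrite ?scale1r ?scaleN1r.
Qed.

Lemma square_atP p u v q : square_frame a u v ->
  square_at p u v q <->
  0 <= dot (q - p) u <= a ^+ 2 /\ 0 <= dot (q - p) v <= a ^+ 2.
Proof.
move=> fuv; have [uu vv uv] := fuv.
have a20 : 0 < a ^+ 2 by rewrite exprn_gt0.
split=> [[s [t [/andP[s0 s1] /andP[t0 t1] ->]]]|[us vt]].
  rewrite -[p + _ + _]addrA [p + _]addrC addrK !dotE uu vv (dotC v u) uv.
  rewrite !mulr0 addr0 add0r.
  by split; rewrite mulr_ge0 ?ler_piMl ?(ltW a20).
have unit c : 0 <= c <= a ^+ 2 -> 0 <= c / a ^+ 2 <= 1.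
  by rewrite ler_pdivlMr// ler_pdivrMr// mul0r mul1r.
exists (dot (q - p) u / a ^+ 2), (dot (q - p) v / a ^+ 2).
split; [exact: unit|exact: unit|].
by rewrite -addrA -plane_frame// addrC subrK.
Qed.

Lemma dot_continuous p u : continuous (fun q => dot (q - p) u).
Proof.
move=> q; rewrite (_ : (fun q => _) = (fun q : 'rV[R]_2 =>
  (q 0 0 - p 0 0) * u 0 0 + (q 0 1 - p 0 1) * u 0 1)).
  have cc i : {for q, continuous (fun q : 'rV[R]_2 => (q 0 i - p 0 i) * u 0 i)}.
    have c0 : (fun q : 'rV[R]_2 => q 0 i) x @[x --> q] --> q 0 i.
      exact: coord_continuous.
    exact: (cvgM (cvgB c0 (cvg_cst (p 0 i))) (cvg_cst (u 0 i))).
  exact: cvgD (cc 0) (cc 1).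
by apply/funext => x; rewrite dot2 !mxE.
Qed.

Lemma square_closed p u v : square_frame a u v -> closed (square_at p u v).
Proof.
move=> fuv; have -> : square_at p u v =
    (fun q => dot (q - p) u) @^-1` `[0, a ^+ 2] `&`
    (fun q => dot (q - p) v) @^-1` `[0, a ^+ 2].
  by apply/seteqP; split=> q /=; rewrite !in_itv; move/(square_atP _ _ fuv).
have cl w : closed ((fun q => dot (q - p) w) @^-1` `[0, a ^+ 2]).
  have /continuous_closedP := @dot_continuous p w.
  by apply; exact: interval_closed.
exact: closedI (cl u) (cl v).
Qed.

Lemma near_dot p u (q : 'rV[R]_2) (lo hi : R) : lo < dot (q - p) u < hi ->
  \forall q' \near q, lo <= dot (q' - p) u <= hi.
Proof.
move=> /andP[lou uhi]; near=> q'; apply/andP; split; apply: ltW; near: q'.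
  exact: cvgr_gt (@dot_continuous p u q) _ lou.
exact: cvgr_lt (@dot_continuous p u q) _ uhi.
Unshelve. all: by end_near. Qed.

Lemma dot_frame p u v s t : square_frame a u v ->
  dot (p + s *: u + t *: v - p) u = a ^+ 2 * s /\
  dot (p + s *: u + t *: v - p) v = a ^+ 2 * t.
Proof.
move=> [uu vv uv]; rewrite -[p + _ + _]addrA [p + _]addrC addrK.
by rewrite !dotE uu vv (dotC v u) uv; split; ring.
Qed.

Lemma square_interior p u v s t (U : set 'rV[R]_2) : square_frame a u v ->
  0 < s < 1 -> 0 < t < 1 -> square_at p u v `<=` U ->
  U^° (p + s *: u + t *: v).
Proof.
move=> fuv /andP[s0 s1] /andP[t0 t1] sU; have [us vt] := dot_frame p s t fuv.
have a20 : 0 < a ^+ 2 by rewrite exprn_gt0.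
rewrite /interior /=; near=> q; apply/sU/(square_atP _ _ fuv); split; near: q.
  by apply: near_dot; rewrite us mulr_gt0// gtr_pMr.
by apply: near_dot; rewrite vt mulr_gt0// gtr_pMr.
Unshelve. all: by end_near. Qed.

Lemma square_frameN u v : square_frame a u v -> square_frame a u (- v).
Proof. by move=> [uu vv uv]; split; rewrite ?dotE ?uv ?vv ?opprK ?oppr0. Qed.

(** The squares on [v] and on [- v] together cover both sides of the line through
[p] along [u]. *)
Lemma common_side_interior p u v s (U : set 'rV[R]_2) : square_frame a u v ->
  0 < s < 1 -> square_at p u v `<=` U -> square_at p u (- v) `<=` U ->
  U^° (p + s *: u).
Proof.
move=> fuv /andP[s0 s1] sU sU'; have [us vt] := dot_frame p s 0 fuv.
have a20 : 0 < a ^+ 2 by rewrite exprn_gt0.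
move: us vt; rewrite scale0r addr0 mulr0 => us vt.
rewrite /interior /=; near=> q.
have qu : 0 <= dot (q - p) u <= a ^+ 2.
  near: q; apply: near_dot; rewrite us mulr_gt0// gtr_pMr//.
have /andP[v0 v1] : - a ^+ 2 <= dot (q - p) v <= a ^+ 2.
  near: q; apply: near_dot; rewrite vt a20 andbT; lra.
have [vge|vlt] := leP 0 (dot (q - p) v).
  by apply/sU/(square_atP _ _ fuv); rewrite qu vge v1.
apply/sU'/(square_atP _ _ (square_frameN fuv)); rewrite qu dotNr; split=> //.
by apply/andP; split; lra.
Unshelve. all: by end_near. Qed.

(** Near the point only the square can contribute to [U], and it does not reach
across its own side: [p + s *: u - e *: v] is outside it for small [e > 0]. *)
Lemma lone_side_not_interior p u v s (U C : set 'rV[R]_2) :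
  square_frame a u v -> U `<=` square_at p u v `|` C -> closed C ->
  ~ C (p + s *: u) -> ~ U^° (p + s *: u).
Proof.
move=> fuv UsC clC nC iU.
have near_in : \forall q \near p + s *: u, dot (q - p) v >= 0.
  near=> q; have [||Cq] := UsC q; first by near: q.
    by case/(square_atP _ _ fuv) => _ /andP[].
  suff : ~ C q by []; near: q.
  by apply: open_nbhs_nbhs; split=> //; exact: closed_openC.
have cv : (fun e : R => p + s *: u - e *: v) @ 0 --> p + s *: u.
  rewrite -[X in _ --> X]subr0 -(scale0r v).
  by apply: cvgB; [exact: cvg_cst|apply: cvgZr_tmp; exact: cvg_id].
have near_e : \forall e \near (0 : R)^'+, dot (p + s *: u - e *: v - p) v >= 0.
  have nz : \forall e \near (0 : R), dot (p + s *: u - e *: v - p) v >= 0.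
    exact: cv near_in.
  by rewrite near_withinE; apply: filterS nz.
have [_ vt] := dot_frame p s 0 fuv.
near (0 : R)^'+ => e.
have : 0 < e by [].
have : dot (p + s *: u - e *: v - p) v >= 0 by near: e.
have [_ vv uv] := fuv.
rewrite -scaleNr; have [_ ->] := dot_frame p s (- e) fuv.
by rewrite pmulr_rge0 ?exprn_gt0// oppr_ge0 ltNge => ->.
Unshelve. all: by end_near. Qed.

(** The complement of an interior is closed, so being non-interior passes from the
inner points of a segment to its ends. *)
Lemma side_not_interior p u s (U : set 'rV[R]_2) :
  (forall s', 0 < s' < 1 -> ~ U^° (p + s' *: u)) -> 0 <= s <= 1 ->
  ~ U^° (p + s *: u).
Proof.
move=> NU s01 iU.
(* The path from [s] to the middle of the segment is inner for positive time. *)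
have cs : (fun e : R => p + (s + e * (2^-1 - s)) *: u) @ 0 --> p + s *: u.
  rewrite -[s in X in _ --> X]addr0 -[X in s + X](mul0r (2^-1 - s)).
  apply: cvgD; [exact: cvg_cst|apply: cvgZr_tmp].
  by apply: cvgD; [exact: cvg_cst|apply: cvgMr_tmp; exact: cvg_id].
have near_e : \forall e \near (0 : R)^'+, U^° (p + (s + e * (2^-1 - s)) *: u).
  have nz : \forall e \near (0 : R), U^° (p + (s + e * (2^-1 - s)) *: u).
    by apply: cs; apply: open_nbhs_nbhs; split=> //; exact: open_interior.
  by rewrite near_withinE; apply: filterS nz.
near (0 : R)^'+ => e.
have e0 : 0 < e by [].
have e1 : e < 1 by near: e; exact: nbhs_right_lt.
suff : ~ U^° (p + (s + e * (2^-1 - s)) *: u) by apply; near: e.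
by apply: NU; nra.
Unshelve. all: by end_near. Qed.
End Plane.

(** * Nets indexed by the faces of the cube *)

(** Below, points of the cube are written in the coordinates in which the cube is
the unit cube, so that vertices are 0/1-vectors and [cube_point] scales lengths by
the side of the cube. *)
Section UnitCube.
Variables (R : realType) (K : cube R).
Local Notation a := (cube_side K).

Definition unit_face (F : 'I_3 * bool) : set 'rV[R]_3 :=
  [set X | (forall i, 0 <= X 0 i <= 1) /\ X 0 F.1 = F.2%:R].

Definition vec (x : cube_vertex) : 'rV[R]_3 := \row_i (x i)%:R.

Definition side (x : cube_vertex) (k : 'I_3) : 'rV[R]_3 :=
  vec (flip x k) - vec x.

Lemma cube_face_image F : cube_face K F = cube_point K @` unit_face F.
Proof.
apply/seteqP; split=> p /= [X].
  by move=> [X01 XF ->]; exists X.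
by move=> [X01 XF] <-; exists X.
Qed.

Lemma cube_point_dist (X Y : 'rV[R]_3) :
  dot (cube_point K X - cube_point K Y) (cube_point K X - cube_point K Y) =
  a ^+ 2 * dot (X - Y) (X - Y).
Proof.
have dotmx n (x y : 'rV[R]_n) : dot x y = (x *m y^T) 0 0.
  by rewrite mxE; apply: eq_bigr => i _; rewrite mxE.
rewrite opprD addrACA subrr add0r -mulmxBl !dotmx trmx_mul mulmxA.
by rewrite -(mulmxA _ (cube_axes K)) cube_axes_orthogonal mul_mx_scalar
  -scalemxAl mxE.
Qed.

Lemma cube_point_inj : injective (cube_point K).
Proof.
move=> X Y XY; apply/eqP; rewrite -subr_eq0; apply/eqP/dot_eq0.
have := cube_point_dist X Y; rewrite XY subrr /dot big1 => [/esym/eqP|i _].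
  by rewrite mulf_eq0 sqrf_eq0 gt_eqF ?cube_side_gt0// => /eqP.
by rewrite !mxE mulr0.
Qed.

Lemma sideE x k i : side x k 0 i = if i == k then (-1) ^+ x k else 0.
Proof.
rewrite !mxE ffunE; case: eqP => [->|_]; last by rewrite addbF subrr.
by case: (x k); rewrite /= ?subr0 ?sub0r ?expr0 ?expr1.
Qed.

Lemma dot3 (j k l : 'I_3) (X Y : 'rV[R]_3) : k != j -> l != j -> l != k ->
  dot X Y = X 0 j * Y 0 j + X 0 k * Y 0 k + X 0 l * Y 0 l.
Proof.
move=> kj lj lk; rewrite /dot (bigD1 j)//= (bigD1 k)//= (bigD1 l) ?lj//=.
rewrite big1 ?addr0 ?addrA// => i /andP[/andP[ij ik] il].
by have := ord3_cover kj lj lk i; rewrite (negPf ij) (negPf ik) (negPf il).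
Qed.

Lemma dot_side x k : dot (side x k) (side x k) = 1.
Proof.
rewrite /dot (bigD1 k)//= big1 => [|i ik]; last first.
  by rewrite sideE (negPf ik) mul0r.
by rewrite sideE eqxx -expr2 sqrr_sign addr0.
Qed.

Lemma dot_side_ortho x k l : k != l -> dot (side x k) (side x l) = 0.
Proof.
move=> kl; rewrite /dot big1// => i _; rewrite !sideE.
by case: eqP => [->|_]; rewrite ?mul0r// (negPf kl) mulr0.
Qed.

Lemma vecD_side x k : vec x + side x k = vec (flip x k).
Proof. by rewrite addrC subrK. Qed.

Lemma face_coord x k l s t i :
  (vec x + s *: side x k + t *: side x l) 0 i =
  (x i)%:R + s * (if i == k then (-1) ^+ x k else 0)
           + t * (if i == l then (-1) ^+ x l else 0).
Proof.
move: (sideE x k i) (sideE x l i); move: (side x k) (side x l) => u v.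
by rewrite !mxE => -> ->.
Qed.

Lemma sign_range (b : bool) (s : R) : 0 <= s <= 1 ->
  0 <= b%:R + s * (-1) ^+ b <= 1.
Proof. by case: b; rewrite /= ?expr1 ?expr0; lra. Qed.

Section Face.
Variables (x : cube_vertex) (j k l : 'I_3).
Hypotheses (kj : k != j) (lj : l != j) (lk : l != k).

(** The face orthogonal to the axis [j] at the vertex [x] is the unit square
spanned from [x] by the sides in the two other directions [k] and [l]. *)
Lemma face_point s t : 0 <= s <= 1 -> 0 <= t <= 1 ->
  unit_face (j, x j) (vec x + s *: side x k + t *: side x l).
Proof.
move=> s01 t01; split=> [i|] /=; rewrite face_coord; last first.
  by rewrite 2![j == _]eq_sym (negPf kj) (negPf lj) !mulr0 !addr0.
case/or3P: (ord3_cover kj lj lk i) => /eqP->.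
- rewrite 2![j == _]eq_sym (negPf kj) (negPf lj) !mulr0 !addr0.
  by case: (x j); rewrite ?lexx ler01.
- by rewrite eqxx eq_sym (negPf lk) mulr0 addr0; exact: sign_range.
- by rewrite eqxx (negPf lk) mulr0 addr0; exact: sign_range.
Qed.

Lemma face_pointP X : unit_face (j, x j) X -> exists s t,
  [/\ 0 <= s <= 1, 0 <= t <= 1 & X = vec x + s *: side x k + t *: side x l].
Proof.
move=> [X01 /= Xj].
exists ((X 0 k - (x k)%:R) * (-1) ^+ x k), ((X 0 l - (x l)%:R) * (-1) ^+ x l).
have range i : 0 <= (X 0 i - (x i)%:R) * (-1) ^+ x i <= 1.
  by have := X01 i; case: (x i); rewrite /= ?expr1 ?expr0; lra.
split=> //; apply/rowP => i; rewrite face_coord.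
have sgK (b : bool) (r : R) : r * (-1) ^+ b * (-1) ^+ b = r.
  by rewrite -mulrA -expr2 sqrr_sign mulr1.
case/or3P: (ord3_cover kj lj lk i) => /eqP->.
- by rewrite 2![j == _]eq_sym (negPf kj) (negPf lj) !mulr0 !addr0.
- by rewrite eqxx eq_sym (negPf lk) mulr0 addr0 sgK addrC subrK.
- by rewrite eqxx (negPf lk) mulr0 addr0 sgK addrC subrK.
Qed.

End Face.

Lemma face_pointB x k l s t s' t' : l != k ->
  let d := vec x + s *: side x k + t *: side x l -
    (vec x + s' *: side x k + t' *: side x l) in
  dot d d = (s - s') ^+ 2 + (t - t') ^+ 2.
Proof.
move=> lk d; have -> : d = (s - s') *: side x k + (t - t') *: side x l.
  rewrite /d; move: (vec x) (side x k) (side x l) => c u w.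
  by apply/rowP => i; rewrite !mxE; ring.
move: (dot_side x k) (dot_side x l) (dot_side_ortho x lk).
move: (side x k) (side x l) => u w uu ww wu.
by rewrite !dotE uu ww (dotC u w) wu; ring.
Qed.

End UnitCube.

Definition joined_faces (R : realType) (a : R)
    (P : 'I_3 * bool -> set 'rV[R]_2) : Prop :=
  forall F F', F != F' -> [\/ P F `&` P F' = set0,
    meet_in_corner a (P F) (P F') | meet_in_edge a (P F) (P F')].

(** A net indexed by the faces of the cube, with [P F] the square that folds onto
the face [F]; [h F] unfolds the face [F] back into the plane. *)
Record development (R : realType) (K : cube R)
    (P : 'I_3 * bool -> set 'rV[R]_2) (f : 'rV[R]_2 -> 'rV[R]_3)
    (h : 'I_3 * bool -> 'rV[R]_3 -> 'rV[R]_2) : Prop := Development {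
  dev_mem : forall F X, unit_face F X -> P F (h F X);
  dev_fold : forall F X, unit_face F X -> f (h F X) = cube_point K X;
  dev_surj : forall F p, P F p -> exists2 X, unit_face F X & p = h F X;
  dev_dist : forall F X Y, unit_face F X -> unit_face F Y ->
    dot (h F X - h F Y) (h F X - h F Y) =
    cube_side K ^+ 2 * dot (X - Y) (X - Y);
  dev_inj : injective P;
  dev_joined : joined_faces (cube_side K) P }.

(** Six squares with six different images among the six faces use every face once,
and an isometry of a square onto a face has an inverse. *)
Lemma unfolding_development (R : realType) (K : cube R)
    (Q : 'I_6 -> set 'rV[R]_2) (f : 'rV[R]_2 -> 'rV[R]_3) :
  unfolding K Q f -> exists (fc : 'I_6 -> 'I_3 * bool) P h,
    [/\ bijective fc, forall i, Q i = P (fc i) & development K P f h].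
Proof.
case=> _ Qinj Qjoin _ [_ _ fiso fface fdist].
have [fc fcE] := choice fface.
have fcinj : injective fc.
  move=> i j ij; apply/eqP/negPn/negP => /fdist; apply.
  by rewrite !fcE ij.
have fcbij : bijective fc.
  by apply: inj_card_bij => //; rewrite card_prod !card_ord card_bool.
have [sq fcK sqK] := fcbij.
pose pre F X p := unit_face F X -> Q (sq F) p /\ f p = cube_point K X.
have preE (FX : ('I_3 * bool) * 'rV[R]_3) : exists p, pre FX.1 FX.2 p.
  case: FX => F X /=.
  have [FX|NFX] := pselect (unit_face F X); last by exists 0.
  have : (f @` Q (sq F)) (cube_point K X).
    by rewrite fcE sqK cube_face_image; exists X.
  by case=> p Qp fp; exists p.
have [h0 h0P] := choice preE.
have hP F X : unit_face F X ->
  Q (sq F) (h0 (F, X)) /\ f (h0 (F, X)) = cube_point K X := h0P (F, X).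
exists fc, (Q \o sq), (fun F X => h0 (F, X)); split=> //.
  by move=> i; rewrite /= fcK.
split=> /=.
- by move=> F X /hP[].
- by move=> F X /hP[].
- move=> F p Qp; have : (f @` Q (sq F)) (f p) by exists p.
  rewrite fcE sqK cube_face_image => -[X FX fX]; exists X => //.
  have [Qh fh] := hP F X FX; apply/eqP; rewrite -subr_eq0; apply/eqP/dot_eq0.
  rewrite -(edist_eq (fiso _ _ _ Qp Qh)) fh fX subrr.
  by apply: big1 => i _; rewrite mxE mul0r.
- move=> F X Y /hP[QX fX] /hP[QY fY].
  by rewrite -(edist_eq (fiso _ _ _ QX QY)) fX fY cube_point_dist.
- by move=> F F' /Qinj/(can_inj sqK).
- move=> F F' FF'; apply: Qjoin; apply: contra FF' => /eqP e.
  by rewrite (can_inj sqK e).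
Qed.

(** * Squares around a vertex and gluing along edges *)

Section Squares.
Variables (R : realType) (K : cube R) (P : 'I_3 * bool -> set 'rV[R]_2).
Variables (f : 'rV[R]_2 -> 'rV[R]_3) (h : 'I_3 * bool -> 'rV[R]_3 -> 'rV[R]_2).
Hypothesis dev : development K P f h.
Local Notation a := (cube_side K).
Local Notation vec := (vec R).
Local Notation side := (side R).
Implicit Types (x y : cube_vertex) (j k l : 'I_3) (X Y : 'rV[R]_3).
Let a0 : 0 < a := cube_side_gt0 K.

Lemma fold_unique F X p : P F p -> f p = cube_point K X ->
  unit_face F X /\ p = h F X.
Proof.
move=> /(dev_surj dev)[Y FY ->]; rewrite (dev_fold dev FY).
by move=> /(@cube_point_inj R K) <-.
Qed.

Definition corner x j := h (j, x j) (vec x).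

(** The planar image, in the square of the face orthogonal to [j] at [x], of the
side of the cube that leaves [x] in the direction [k]. *)
Definition arm x j k := h (j, x j) (vec (flip x k)) - corner x j.

Lemma vec_face x j : unit_face (j, x j) (vec x).
Proof. by split=> [i|]; rewrite mxE//=; case: (x i); rewrite ?lexx ler01. Qed.

Lemma vec_flip_face x j k : k != j -> unit_face (j, x j) (vec (flip x k)).
Proof.
by rewrite eq_sym => jk; rewrite -(flip_off x jk); exact: vec_face.
Qed.

Section Corner.
Variables (x : cube_vertex) (j k l : 'I_3).
Hypotheses (kj : k != j) (lj : l != j) (lk : l != k).

Let vec_k : vec (flip x k) = vec x + 1 *: side x k + 0 *: side x l.
Proof. by rewrite scale0r addr0 scale1r vecD_side. Qed.

Let vec_l : vec (flip x l) = vec x + 0 *: side x k + 1 *: side x l.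
Proof. by rewrite scale0r addr0 scale1r vecD_side. Qed.

Let vec_0 : vec x = vec x + 0 *: side x k + 0 *: side x l.
Proof. by rewrite !scale0r !addr0. Qed.

(** Orthogonality follows from the length of the diagonal of the face. *)
Lemma arm_frame : square_frame a (arm x j k) (arm x j l).
Proof.
have hx := vec_face x j.
have hk := vec_flip_face x kj; have hl := vec_flip_face x lj.
have uu : dot (arm x j k) (arm x j k) = a ^+ 2.
  rewrite (dev_dist dev hk hx) vec_k [X in _ - X]vec_0 face_pointB//; ring.
have vv : dot (arm x j l) (arm x j l) = a ^+ 2.
  rewrite (dev_dist dev hl hx) vec_l [X in _ - X]vec_0 face_pointB//; ring.
split=> //.
have : dot (arm x j k - arm x j l) (arm x j k - arm x j l) = a ^+ 2 * 2.
  have -> : arm x j k - arm x j l =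
      h (j, x j) (vec (flip x k)) - h (j, x j) (vec (flip x l)).
    by rewrite /arm opprB addrA subrK.
  rewrite (dev_dist dev hk hl) vec_k vec_l face_pointB//; ring.
move: (arm x j k) (arm x j l) uu vv => u v uu vv.
rewrite !dotE uu vv (dotC v u); lra.
Qed.

(** Unfolding preserves the distances to three corners of the face, hence
is affine. *)
Lemma fold_corner s t : 0 <= s <= 1 -> 0 <= t <= 1 ->
  h (j, x j) (vec x + s *: side x k + t *: side x l) =
  corner x j + s *: arm x j k + t *: arm x j l.
Proof.
move=> s01 t01; have [uu vv uv] := arm_frame.
have hx := vec_face x j; have hX := face_point x kj lj lk s01 t01.
have hk := vec_flip_face x kj; have hl := vec_flip_face x lj.
have armD i : corner x j + arm x j i = h (j, x j) (vec (flip x i)).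
  by rewrite addrC subrK.
apply: (frame_trilateration uu vv uv); rewrite ?armD (dev_dist dev)//.
- by rewrite [X in _ - X]vec_0 face_pointB// !subr0.
- by rewrite vec_k face_pointB//; ring.
- by rewrite vec_l face_pointB//; ring.
Qed.

Lemma square_corner :
  P (j, x j) = square_at (corner x j) (arm x j k) (arm x j l).
Proof.
apply/seteqP; split=> [p /(dev_surj dev)[X FX ->]|p [s [t [s01 t01 ->]]]].
  have [s [t [s01 t01 ->]]] := face_pointP kj lj lk FX.
  by exists s, t; rewrite fold_corner.
by rewrite -fold_corner//; apply: (dev_mem dev); exact: face_point.
Qed.

End Corner.

(** The edge of the cube that leaves [x] in the direction [k] lies in the two
faces orthogonal to [j] and to [l] at [x]; being glued means that these faces
unfold the edge to the same planar segment. *)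
Definition glued x k j l := corner x j = corner x l /\ arm x j k = arm x l k.

Lemma glued_sym x k j l : glued x k j l -> glued x k l j.
Proof. by case. Qed.

Lemma shared_point F F' p : P F p -> P F' p ->
  exists X, [/\ unit_face F X, unit_face F' X, p = h F X & p = h F' X].
Proof.
move=> /(dev_surj dev)[X FX ->] F'p; exists X.
by have [] := fold_unique F'p (dev_fold dev FX).
Qed.

(** Opposite faces of the cube are disjoint. *)
Lemma shared_point_axes F F' X : F != F' -> unit_face F X -> unit_face F' X ->
  F.1 != F'.1.
Proof.
case: F F' => [j b] [l c] FF' [_ /= Xj] [_ /= Xl]; apply: contra FF' => /eqP jl.
move: Xj; rewrite jl Xl => /eqP; rewrite eqr_nat; clear.
by case: b c => [] [].
Qed.

Lemma face_square_closed F : closed (P F).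
Proof.
case: F => j b; pose x : cube_vertex := [ffun=> b].
have [k /andP[kj _]] := ord3_third j j; have [l /andP[lj lk]] := ord3_third j k.
have -> : (j, b) = (j, x j) by rewrite ffunE.
rewrite (square_corner x kj lj lk).
exact: square_closed (arm_frame x kj lj lk).
Qed.

Section Edge.
Variables (x : cube_vertex) (j k l : 'I_3).
Hypotheses (kj : k != j) (lj : l != j) (lk : l != k).

Lemma edge_endpoint y (X : 'rV[R]_3) : unit_face (j, x j) X ->
  unit_face (l, x l) X -> y j = x j -> y l = x l -> X 0 k = (y k)%:R ->
  X = vec y.
Proof.
move=> [_ /= Xj] [_ /= Xl] yj yl Xk; apply/rowP => i; rewrite mxE.
by case/or3P: (ord3_cover kj lj lk i) => /eqP->; rewrite // ?yj ?yl.
Qed.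

(** The ends of the common planar side fold to two points of the common edge of
the faces at distance one, which can only be the ends of this edge. *)
Lemma meet_in_edge_glued :
  meet_in_edge a (P (j, x j)) (P (l, x l)) -> glued x k j l.
Proof.
have jl : (j, x j) != (l, x l).
  by apply: contra lj => /eqP[->].
have kl : k != l by rewrite eq_sym.
case=> A [[p [u [v [[uu _ _] _ AE]]]] _ PA].
have A01 s : 0 <= s <= 1 -> A (p + s *: u).
  by move=> s01; rewrite AE; exists s => //; rewrite [p + u]addrC addrK.
have [X [jX lX hjX hlX]] : exists X, [/\ unit_face (j, x j) X,
    unit_face (l, x l) X, p = h (j, x j) X & p = h (l, x l) X].
  have := A01 0; rewrite scale0r addr0 -PA lexx ler01.
  by case=> // ? ?; exact: shared_point.
have [Y [jY lY hjY hlY]] : exists X, [/\ unit_face (j, x j) X,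
    unit_face (l, x l) X, p + u = h (j, x j) X & p + u = h (l, x l) X].
  have := A01 1; rewrite scale1r -PA lexx ler01.
  by case=> // ? ?; exact: shared_point.
have : dot (Y - X) (Y - X) = 1.
  apply: (@mulfI _ (a ^+ 2)); first by rewrite sqrf_eq0 gt_eqF.
  by rewrite -(dev_dist dev jY jX) -hjX -hjY addrC addKr uu mulr1.
rewrite (dot3 _ _ kj lj lk) !mxE.
have [X01 /= ->] := jX; have [_ /= ->] := lX.
have [Y01 /= ->] := jY; have [_ /= ->] := lY.
rewrite !subrr !mul0r addr0 add0r => XY1.
have /andP[X0 X1] := X01 k; have /andP[Y0 Y1] := Y01 k.
(* Two numbers in [0, 1] whose difference squares to 1 are 0 and 1. *)
have XY : exists b : bool, X 0 k = b%:R /\ Y 0 k = (~~ b)%:R.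
  have : (Y 0 k - X 0 k) ^+ 2 == 1 by rewrite expr2 XY1.
  by rewrite sqrf_eq1 => /orP[]/eqP XY;
    [exists false|exists true] => /=; split; lra.
have [b [Xk Yk]] := XY.
have jk : j != k by rewrite eq_sym.
have [[XE YE]|[XE YE]] : X = vec x /\ Y = vec (flip x k) \/
    X = vec (flip x k) /\ Y = vec x.
- have [bx|bx] := eqVneq b (x k); [left|right]; split;
    apply: edge_endpoint; rewrite ?flip_at ?Xk ?Yk ?bx ?flip_off //;
    by case: b (x k) bx {Xk Yk} => [] [].
- have cE : corner x j = corner x l by rewrite /corner -XE -hjX.
  by split=> //; rewrite /arm cE -YE -hjY -hlY.
- have cE : corner x j = corner x l by rewrite /corner -YE -hjY.
  by split=> //; rewrite /arm cE -XE -hjX -hlX.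
Qed.


Definition net := \bigcup_(F in [set: 'I_3 * bool]) P F.

Lemma edge_point_face s : 0 <= s <= 1 ->
  unit_face (j, x j) (vec x + s *: side x k).
Proof.
move=> s01; rewrite -[_ + _]addr0 -(scale0r (side x l)).
by apply: face_point; rewrite ?lexx ?ler01.
Qed.

Lemma fold_edge_point s : 0 <= s <= 1 ->
  h (j, x j) (vec x + s *: side x k) = corner x j + s *: arm x j k.
Proof.
move=> s01; rewrite -[_ + _ *: side _ _]addr0 -(scale0r (side x l)).
by rewrite (fold_corner x kj lj lk) ?lexx ?ler01// scale0r addr0.
Qed.

Lemma edge_point_coord s i : i != k ->
  (vec x + s *: side x k) 0 i = (x i)%:R.
Proof.
move=> ik; have := @face_coord R x k k s 0 i.
by rewrite (negPf ik) scale0r mulr0 mulr0 !addr0.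
Qed.

Lemma edge_point_coord_inner s : 0 < s < 1 ->
  0 < (vec x + s *: side x k) 0 k < 1.
Proof.
move=> s01; have := @face_coord R x k k s 0 k.
rewrite eqxx scale0r mul0r !addr0 => ->.
by case: (x k); rewrite /= ?expr1 ?expr0; lra.
Qed.

Lemma inner_point_faces s F : 0 < s < 1 ->
  unit_face F (vec x + s *: side x k) -> F = (j, x j) \/ F = (l, x l).
Proof.
case: F => i b s01 [_ /= Xi]; have := edge_point_coord_inner s01.
have [ik|ik] := eqVneq i k.
  by move: Xi; rewrite ik => ->; case: (b); rewrite /= ?ltxx ?andbF.
move: Xi; rewrite edge_point_coord// => /eqP; rewrite eqr_nat => xb _.
have -> : b = x i by move: xb; case: b (x i) => [] [].
by case/or3P: (ord3_cover kj lj lk i) ik => /eqP->; rewrite ?eqxx;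
  [left|by []|right].
Qed.

(** The squares cannot meet just in a corner at a point that folds into the inside
of an edge: a corner of a square has an opposite corner, at squared distance 2 in
the unit cube, and an inner point of an edge has no such partner in the face. *)
Lemma inner_point_glued s F : 0 < s < 1 -> F != (j, x j) ->
  P F (h (j, x j) (vec x + s *: side x k)) -> F = (l, x l) /\ glued x k j l.
Proof.
move=> s01 Fj Fp; have s01' : 0 <= s <= 1 by lra.
have jX := edge_point_face s01'; have jp := dev_mem dev jX.
have [FX _] := fold_unique Fp (dev_fold dev jX).
have [Fj'|Fl] := inner_point_faces s01 FX; first by rewrite Fj' eqxx in Fj.
split=> //; rewrite Fl {FX Fl} in Fj Fp.
rewrite eq_sym in Fj.
have in_both : (P (j, x j) `&` P (l, x l)) (h (j, x j) (vec x + s *: side x k)).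
  by [].
have [disj|[c [[u [v [[uu vv uv] PE]]] _ PI]]|] := dev_joined dev Fj.
- by rewrite disj in in_both.
- have pc : h (j, x j) (vec x + s *: side x k) = c by rewrite PI in in_both.
  have : P (j, x j) (c + 1 *: u + 1 *: v).
    by rewrite PE; exists 1, 1; rewrite ler01 lexx.
  move=> /(dev_surj dev)[Y jY hY].
  have := dev_dist dev jY jX.
  rewrite -hY pc !scale1r -[c + u + v]addrA [c + _]addrC addrK.
  have -> : dot (u + v) (u + v) = a ^+ 2 * 2.
    by rewrite !dotE uu vv (dotC v u) uv; ring.
  have [s' [t' [s01'' t01 ->]]] := face_pointP kj lj lk jY.
  have XE : vec x + s *: side x k = vec x + s *: side x k + 0 *: side x l.
    by rewrite scale0r addr0.
  rewrite XE face_pointB// => dist2.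
  have : (s' - s) ^+ 2 + (t' - 0) ^+ 2 = 2.
    apply: (@mulfI _ (a ^+ 2)); first by rewrite sqrf_eq0 gt_eqF.
    by rewrite -dist2.
  nra.
- exact: meet_in_edge_glued.
Qed.

Lemma face_interior s t : 0 < s < 1 -> 0 < t < 1 ->
  net^° (h (j, x j) (vec x + s *: side x k + t *: side x l)).
Proof.
move=> s01 t01; have fr := arm_frame x kj lj lk.
rewrite (fold_corner x kj lj lk); try lra.
apply: (square_interior a0 fr) => //; rewrite -(square_corner x kj lj lk).
by move=> p; exists (j, x j).
Qed.

(** The other squares form a closed set that avoids the point. *)
Lemma inner_point_boundary s : 0 < s < 1 -> ~ glued x k j l ->
  ~ net^° (h (j, x j) (vec x + s *: side x k)).
Proof.
move=> s01 Ng; have s01' : 0 <= s <= 1 by lra.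
rewrite fold_edge_point//.
pose C := \bigcup_(F in [set F | F != (j, x j)]) P F.
apply: (@lone_side_not_interior _ _ a0 _ _ _ _ _ C (arm_frame x kj lj lk)).
- move=> p [F _ Fp]; have [Fj|Fj] := eqVneq F (j, x j).
    by left; rewrite -square_corner// -Fj.
  by right; exists F.
- apply: closed_bigcup => [|F _]; first exact: finite_finset.
  exact: face_square_closed.
- move=> [F /= Fj Fp]; apply: Ng.
  by rewrite -fold_edge_point// in Fp; have [] := inner_point_glued s01 Fj Fp.
Qed.

(** Otherwise both squares would have the same corner and the same arms. *)
Lemma glued_opposite : glued x k j l -> arm x l j = - arm x j l.
Proof.
move=> [cjl kjl]; have kl : k != l by rewrite eq_sym.
have jl : j != l by rewrite eq_sym.
have jk : j != k by rewrite eq_sym.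
have frj := arm_frame x kj lj lk; have frl := arm_frame x kl jl jk.
rewrite -kjl in frl; have [same|//] := orthogonal_pm a0 frj frl.
suff : (j, x j) = (l, x l) by case=> /eqP; rewrite (negPf jl).
apply: (dev_inj dev).
by rewrite (square_corner x kj lj lk) (square_corner x kl jl jk) cjl kjl same.
Qed.

Lemma glued_interior s : 0 < s < 1 -> glued x k j l ->
  net^° (h (j, x j) (vec x + s *: side x k)).
Proof.
move=> s01 g; have s01' : 0 <= s <= 1 by lra.
have [cjl kjl] := g; rewrite fold_edge_point//.
have kl : k != l by rewrite eq_sym.
have jl : j != l by rewrite eq_sym.
have jk : j != k by rewrite eq_sym.
apply: (common_side_interior a0 (arm_frame x kj lj lk)) => //.
  by rewrite -square_corner// => p; exists (j, x j).
rewrite -glued_opposite// kjl cjl -square_corner// => p Pp.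
by exists (l, x l).
Qed.

End Edge.

(** Crossing a glued side reverses the arm that leaves it.  Going once around the
vertex would identify the two orthogonal arms of one square. *)
Lemma no_three_glued x j k l : k != j -> l != j -> l != k ->
  glued x k j l -> glued x j k l -> glued x l j k -> False.
Proof.
move=> kj lj lk gk gj gl.
have kl : k != l by rewrite eq_sym.
have jl : j != l by rewrite eq_sym.
have jk : j != k by rewrite eq_sym.
have [_ el] := gl.
have ok := glued_opposite kj lj lk gk.
have oj := glued_opposite jk lk lj gj.
have [uu _ uv] := arm_frame x jl kl kj.
have eq_arms : arm x l j = arm x l k by rewrite ok oj el.
move: uu; rewrite {2}eq_arms uv => /esym/eqP.
by rewrite sqrf_eq0 gt_eqF.
Qed.

End Squares.

(** * The cut edges *)

Lemma flip_side (R : realType) x k l : l != k ->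
  side R (flip x k) l = side R x l.
Proof.
move=> lk; apply/rowP => i; rewrite !sideE flip_off//.
Qed.

Lemma edge_segmentP (R : realType) (K : cube R) x k :
  edge_segment K [set x; flip x k]%SET =
  segment (vertex_pos K x) (vertex_pos K (flip x k)).
Proof.
apply/seteqP; split=> p; last by move=> xp; exists x, (flip x k).
case=> y [z [/setP E [s s01 ->]]].
have fx := flip_neq x k.
have : y \in [set x; flip x k]%SET by rewrite E !inE eqxx.
have : z \in [set x; flip x k]%SET by rewrite E !inE eqxx orbT.
have : x \in [set y; z]%SET by rewrite -E !inE eqxx.
have : flip x k \in [set y; z]%SET by rewrite -E !inE eqxx orbT.
rewrite !inE => fyz xyz /orP[]/eqP zE /orP[]/eqP yE;
  rewrite {}yE {}zE ?orbb ?(negPf fx) ?[x == flip _ _]eq_sym ?(negPf fx)// in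
    fyz xyz *.
- exists (1 - s); first by lra.
  move: (vertex_pos K x) (vertex_pos K (flip x k)) => u v.
  by apply/rowP => i; rewrite !mxE; ring.
- by exists s.
Qed.

Lemma segment_cube_point (R : realType) (K : cube R) x k p :
  segment (vertex_pos K x) (vertex_pos K (flip x k)) p <->
  exists2 s, 0 <= s <= 1 & p = cube_point K (vec R x + s *: side R x k).
Proof.
have E s : vertex_pos K x + s *: (vertex_pos K (flip x k) - vertex_pos K x) =
    cube_point K (vec R x + s *: side R x k).
  rewrite /vertex_pos -!/(vec R _) /cube_point opprD addrACA subrr add0r.
  by rewrite -mulmxBl -/(side R x k) -addrA scalemxAl -mulmxDl.
by split=> -[s s01 ->]; exists s; rewrite ?E.
Qed.

Lemma edge_segment_closed (R : realType) (K : cube R) A :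
  A \in graph_edges cube_adj -> closed (edge_segment K A).
Proof.
case/cube_edgeP=> x [k ->]; rewrite edge_segmentP.
move: (vertex_pos K x) (vertex_pos K (flip x k)) => p q.
have -> : segment p q = (fun t : R => p + t *: (q - p)) @` `[0, 1].
  apply/seteqP; split=> z /=.
    by move=> [t t01 ->]; exists t; rewrite //= in_itv.
  by move=> [t /=]; rewrite in_itv /= => t01 <-; exists t.
apply: compact_closed; first exact: norm_hausdorff.
apply: continuous_compact; last exact: segment_compact.
apply: continuous_subspaceT => t.
by apply: cvgD; [exact: cvg_cst|apply: cvgZr_tmp; exact: cvg_id].
Qed.

(** Rounding down sends each point of an edge to one of the two ends of this edge.
As it depends on the point alone, edges of the cube that meet as segments share a
vertex. *)
Definition floor_vertex (R : realType) (X : 'rV[R]_3) : cube_vertex :=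
  [ffun i => X 0 i == 1].

Lemma floor_vertex_edge (R : realType) (K : cube R) A X :
  A \in graph_edges cube_adj -> edge_segment K A (cube_point K X) ->
  floor_vertex X \in A.
Proof.
case/cube_edgeP=> x [k ->]; rewrite edge_segmentP => /segment_cube_point[s _].
move=> /(@cube_point_inj R K) ->; set X' := _ + _.
have off i : i != k -> floor_vertex X' i = x i.
  move=> ik; rewrite ffunE edge_point_coord//.
  by case: (x i); rewrite ?eqxx// eq_sym oner_eq0.
have [xk|xk] := eqVneq (floor_vertex X' k) (x k).
  suff -> : floor_vertex X' = x by rewrite !inE eqxx.
  by apply/ffunP => i; have [->|/off] := eqVneq i k.
suff -> : floor_vertex X' = flip x k by rewrite !inE eqxx orbT.
apply/ffunP => i; have [->|ik] := eqVneq i k; last by rewrite off// flip_off.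
by rewrite flip_at; case: (x k) (_ k) xk => [] [].
Qed.

Section Cut.
Variables (R : realType) (K : cube R) (P : 'I_3 * bool -> set 'rV[R]_2).
Variables (f : 'rV[R]_2 -> 'rV[R]_3) (h : 'I_3 * bool -> 'rV[R]_3 -> 'rV[R]_2).
Hypothesis dev : development K P f h.
Variable T : subgraph cube_adj.
Local Notation net := (net P).
Local Notation glued := (glued h).
Hypothesis cutT : forall A, A \in sg_edges T <->
  A \in graph_edges cube_adj /\ edge_segment K A `<=` f @` boundary net.
Implicit Types (x y : cube_vertex) (j k l : 'I_3).

Lemma net_closed : closed net.
Proof.
apply: closed_bigcup => [|F _]; first exact: finite_finset.
exact: (face_square_closed dev).
Qed.

Lemma boundary_net b : boundary net b <-> net b /\ ~ net^° b.
Proof. by rewrite /boundary -(closure_id _).1//; exact: net_closed. Qed.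

(** A glued edge has its midpoint outside the image of the boundary, since the two
glued squares are the only ones that can fold onto it, and they do so from the
same interior point of the net.  An edge that is not glued unfolds into the
boundary at its inner points, hence also at its ends. *)
Lemma cut_not_glued x j k l : k != j -> l != j -> l != k ->
  [set x; flip x k]%SET \in sg_edges T <-> ~ glued x k j l.
Proof.
move=> kj lj lk; have kl : k != l by rewrite eq_sym.
have jl : j != l by rewrite eq_sym.
have jk : j != k by rewrite eq_sym.
split=> [/cutT[_ seg] g|Ng].
  have half : 0 < (2^-1 : R) < 1 by lra.
  have half' : 0 <= (2^-1 : R) <= 1 by lra.
  have : edge_segment K [set x; flip x k]%SET
      (cube_point K (vec R x + 2^-1 *: side R x k)).
    by rewrite edge_segmentP; apply/segment_cube_point; exists 2^-1.
  move=> /seg[b /boundary_net[[F _ Fb] Nb] fb]; apply: Nb.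
  have [FX ->] := fold_unique dev Fb fb.
  have [->|->] := inner_point_faces kj lj lk half FX.
    exact: (glued_interior dev kj lj lk half).
  by apply: (glued_interior dev kl jl jk half); exact: glued_sym.
apply/cutT; split; first exact: flip_edge.
rewrite edge_segmentP => p /segment_cube_point[s s01 ->].
have jX := edge_point_face x kj lj lk s01.
exists (h (j, x j) (vec R x + s *: side R x k)); last exact: (dev_fold dev jX).
apply/boundary_net; split.
  by exists (j, x j) => //; exact: (dev_mem dev jX).
rewrite (fold_edge_point dev x kj lj lk)//; apply: side_not_interior s01.
move=> s' s01'; have s01'' : 0 <= s' <= 1 by lra.
rewrite -(fold_edge_point dev x kj lj lk)//.
exact: (inner_point_boundary dev kj lj lk s01' Ng).
Qed.

Lemma vertex_cut x : exists k, [set x; flip x k]%SET \in sg_edges T.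
Proof.
apply: contrapT => none.
have all_glued j k l : k != j -> l != j -> l != k -> glued x k j l.
  move=> kj lj lk; apply: contrapT => Ng; apply: none; exists k.
  by apply/(cut_not_glued x kj lj lk).
apply: (@no_three_glued _ _ _ _ _ dev x 0 1 2%:R); rewrite //; exact: all_glued.
Qed.

Lemma vertex_segment x k : edge_segment K [set x; flip x k]%SET
  (cube_point K (vec R x)).
Proof.
rewrite edge_segmentP; apply/segment_cube_point; exists 0.
  by rewrite lexx ler01.
by rewrite scale0r addr0.
Qed.

Lemma boundary_edge_cut x j k l s : k != j -> l != j -> l != k ->
  0 <= s <= 1 -> ~ net^° (h (j, x j) (vec R x + s *: side R x k)) ->
  exists2 A, A \in sg_edges T &
    edge_segment K A (cube_point K (vec R x + s *: side R x k)).
Proof.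
move=> kj lj lk s01 Nint.
have [s0|s0] := eqVneq s 0.
  have [m xm] := vertex_cut x; exists [set x; flip x m]%SET => //.
  by rewrite s0 scale0r addr0; exact: vertex_segment.
have [s1|s1] := eqVneq s 1.
  have [m xm] := vertex_cut (flip x k).
  exists [set flip x k; flip (flip x k) m]%SET => //.
  by rewrite s1 scale1r vecD_side; exact: vertex_segment.
exists [set x; flip x k]%SET.
  apply/(cut_not_glued x kj lj lk) => g; apply: Nint.
  apply: (glued_interior dev kj lj lk) g.
  by case/andP: s01; rewrite le_eqVlt eq_sym (negPf s0)/= => ->;
    rewrite le_eqVlt (negPf s1).
by rewrite edge_segmentP; apply/segment_cube_point; exists s.
Qed.

(** A boundary point folds to the rim of a face.  At an inner point of an edge,
that edge is cut; at a vertex, some cut edge passes. *)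
Lemma boundary_image b : boundary net b ->
  exists2 A, A \in sg_edges T & edge_segment K A (f b).
Proof.
move=> /boundary_net[[[j c] _ /(dev_surj dev)[X FX bX]] Nint].
rewrite bX (dev_fold dev FX); move: Nint; rewrite bX {b bX}.
pose x : cube_vertex := [ffun=> c].
have [k /andP[kj _]] := ord3_third j j; have [l /andP[lj lk]] := ord3_third j k.
have kl : k != l by rewrite eq_sym.
have cx : c = x j by rewrite ffunE.
rewrite cx in FX *; have [s [t [s01 t01 ->]]] := face_pointP kj lj lk FX.
have [s0|s0] := eqVneq s 0.
  by rewrite s0 scale0r addr0; exact: (boundary_edge_cut lj kj kl t01).
have [s1|s1] := eqVneq s 1.
  have jk : j != k by rewrite eq_sym.
  rewrite s1 scale1r vecD_side -(flip_side R x lk) -(flip_off x jk).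
  exact: (boundary_edge_cut lj kj kl t01).
have [t0|t0] := eqVneq t 0.
  by rewrite t0 scale0r addr0; exact: (boundary_edge_cut kj lj lk s01).
have [t1|t1] := eqVneq t 1.
  have jl : j != l by rewrite eq_sym.
  rewrite t1 scale1r addrAC vecD_side -(flip_side R x kl) -(flip_off x jl).
  exact: (boundary_edge_cut kj lj lk s01).
case; apply: (face_interior dev x kj lj lk).
  by case/andP: s01; rewrite le_eqVlt eq_sym (negPf s0)/= => ->;
    rewrite le_eqVlt (negPf s1).
by case/andP: t01; rewrite le_eqVlt eq_sym (negPf t0)/= => ->;
  rewrite le_eqVlt (negPf t1).
Qed.

(** If some vertex were out of reach of [x0], then the cut edges within reach and
the others would split the connected image of the boundary into two nonempty
closed sets. *)
Lemma cut_connected : connected (f @` boundary net) ->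
  forall x y, connect (sg_adj T) x y.
Proof.
move=> conZ x0 y0; pose reach := connect (sg_adj T) x0.
have graphT A : A \in sg_edges T -> A \in graph_edges cube_adj.
  exact/fintype.subsetP/sg_edges_sub.
have reach_edge A y z : A \in sg_edges T -> y \in A -> z \in A ->
    reach y -> reach z.
  move=> AT; have [x [k AE]] := cube_edgeP (graphT _ AT).
  have xk : sg_adj T x (flip x k) by rewrite /sg_adj -AE.
  have kx : sg_adj T (flip x k) x by rewrite /sg_adj finset.setUC -AE.
  by rewrite AE !inE => /orP[]/eqP-> /orP[]/eqP-> // ry;
    apply: connect_trans ry _; exact: connect1.
pose part (Q : pred cube_vertex) := \bigcup_(A in
  [set A | A \in sg_edges T /\ exists2 y, y \in A & Q y]) edge_segment K A.
have part_closed Q : closed (part Q).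
  apply: closed_bigcup => [|A [AT _]]; first exact: finite_finset.
  exact/edge_segment_closed/graphT.
have part_sub Q : part Q `<=` f @` boundary net.
  by move=> p [A [/cutT[_ sub] _] /sub].
have part_disj p : part reach p -> part (predC reach) p -> False.
  move=> [A [AT [y yA ry]] Ap] [B [BT [z zB /negP zr]] Bp]; apply: zr.
  have [X pX] : exists X, p = cube_point K X.
    have [x [k AE]] := cube_edgeP (graphT _ AT).
    move: Ap; rewrite AE edge_segmentP => /segment_cube_point[s _ ->].
    by eexists.
  rewrite {}pX in Ap Bp.
  apply: (reach_edge _ _ _ BT (floor_vertex_edge (graphT _ BT) Bp) zB).
  exact: (reach_edge _ _ _ AT yA (floor_vertex_edge (graphT _ AT) Ap)).
have vertex_part (Q : pred cube_vertex) x : Q x ->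
    part Q (cube_point K (vec R x)).
  move=> Qx; have [k kT] := vertex_cut x; exists [set x; flip x k]%SET.
    by split=> //; exists x; rewrite // !inE eqxx.
  exact: vertex_segment.
apply: contrapT => /negP Ny.
have full : part reach = f @` boundary net.
  apply: conZ.
  - by exists (cube_point K (vec R x0)); apply: vertex_part; exact: connect0.
  - exists (~` part (predC reach)); first exact: closed_openC.
    apply/seteqP; split=> p.
      by move=> rp; split; [exact: part_sub rp|exact: part_disj].
    move=> [[b bb <-] Np]; have [A AT Ab] := boundary_image bb.
    have [x [k AE]] := cube_edgeP (graphT _ AT).
    exists A => //; split=> //; exists x; first by rewrite AE !inE eqxx.
    apply: contrapT => /negP rx; apply: Np; exists A => //.
    by split=> //; exists x => //; rewrite AE !inE eqxx.
  - exists (part reach) => //.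
    by rewrite setIidr//; exact: part_sub.
have y0p := vertex_part (predC reach) y0 Ny.
by apply: (part_disj _ _ y0p); rewrite full; exact: part_sub y0p.
Qed.

End Cut.

(** * Spanning trees *)

Lemma single_component_connected (X : topologicalType) (A : set X) :
  single_component A -> connected A.
Proof.
case=> C CE; have : (connected_component A @` A) C by rewrite CE.
case=> x Ax xC; suff -> : A = connected_component A x.
  exact: component_connected.
apply/seteqP; split; last exact: connected_component_sub.
move=> y Ay; have : [set C] (connected_component A y).
  by rewrite -CE; exists y.
by rewrite xC => /= <-; exact: connected_component_refl.
Qed.

Lemma meet_in_edge_vertex (R : realType) (K : cube R)
    (P : 'I_3 * bool -> set 'rV[R]_2) f h F F' :
  development K P f h -> F != F' -> meet_in_edge (cube_side K) (P F) (P F') ->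
  exists (x : cube_vertex) j k l, 
    [/\ k != j, l != j, l != k, F = (j, x j) & F' = (l, x l)].
Proof.
case: F F' => [j b] [l c] dev FF' [A [[p [u [v [_ _ AE]]]] _ PA]].
have : (P (j, b) `&` P (l, c)) p.
  rewrite PA AE; exists 0; first by rewrite lexx ler01.
  by rewrite scale0r addr0.
case=> Pp P'p; have [X [FX F'X _ _]] := shared_point dev Pp P'p.
have jl : j != l := shared_point_axes FF' FX F'X.
have [k /andP[kj kl]] := ord3_third j l.
exists [ffun i => if i == j then b else c], j, k, l.
by split; rewrite ?ffunE ?eqxx // eq_sym // (negPf jl).
Qed.

(** Sending an uncut edge to the pair of squares whose faces contain it reaches
every pair of squares that meet in a side; these pairs connect the six squares, so
there are at least five uncut edges out of twelve. *)
Lemma cut_edges_bound (R : realType) (K : cube R) (Q : 'I_6 -> set 'rV[R]_2)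
    (P : 'I_3 * bool -> set 'rV[R]_2) f h (fc : 'I_6 -> 'I_3 * bool)
    (T : subgraph cube_adj) :
  development K P f h -> injective fc -> (forall i, Q i = P (fc i)) ->
  chain_connected (cube_side K) Q ->
  (forall A, A \in sg_edges T <-> A \in graph_edges cube_adj /\
     edge_segment K A `<=` f @` boundary (net P)) ->
  (#|sg_edges T| < 8)%N.
Proof.
move=> dev fcI QE chain cutT.
pose carriers (A : {set cube_vertex}) :=
  [set i | A \subset [set x : cube_vertex | x (fc i).1 == (fc i).2]]%SET.
pose D := [set carriers A | A in graph_edges cube_adj :\: sg_edges T]%SET.
have : (#|'I_6| <= #|D|.+1)%N.
  apply: connected_leq_card_edges => i j; apply: connect_sub (chain i j).
  move=> {}i {}j /asboolP.
  have [->|ij] := eqVneq i j; first by rewrite connect0.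
  rewrite !QE => meet; have Fij : fc i != fc j by rewrite (inj_eq fcI).
  have [x [m [k [l [km lm lk iE jE]]]]] := meet_in_edge_vertex dev Fij meet.
  apply: connect1; apply/imsetP; exists [set x; flip x k]%SET.
    rewrite inE flip_edge andbT; apply/negP.
    move=> /(cut_not_glued dev cutT x km lm lk).
    by apply; apply: (meet_in_edge_glued dev km lm lk); rewrite -iE -jE.
  have kN m' d : x m' = d -> flip x k m' = d -> m' != k.
    by move=> <- e; apply/eqP => mk; move: e; rewrite mk flip_at; case: (x k).
  have jm : m != k by rewrite eq_sym.
  apply/setP => i'; rewrite !inE finset.subUset !finset.sub1set !inE.
  apply/idP/idP => [|/andP[/eqP xi fxi]].
    by case/orP=> /eqP->; rewrite ?iE ?jE /= flip_off ?eqxx.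
  move: fxi; rewrite -xi => /eqP /(kN _ _ erefl) i'k.
  have fcE : fc i' = ((fc i').1, x (fc i').1).
    by rewrite xi -surjective_pairing.
  case/or3P: (ord3_cover km lm lk (fc i').1) => /eqP e.
  - by apply/orP; left; apply/eqP/fcI; rewrite fcE e iE.
  - by rewrite e eqxx in i'k.
  - by apply/orP; right; apply/eqP/fcI; rewrite fcE e jE.
rewrite card_ord ltnS => leD.
have uncut_ge5 : (5 <= #|graph_edges cube_adj| - #|sg_edges T|)%N.
  rewrite -(finset.cardsDS (sg_edges_sub T)).
  exact: leq_trans leD (leq_imset_card _ _).
have le7 := leq_trans uncut_ge5 (leq_sub2r _ card_cube_edges).
by rewrite ltnNge; apply/negP => /(leq_sub2l 12)/(leq_trans le7).
Qed.

Theorem proposition1 (R : realType) (K : cube R)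
    (Q : 'I_6 -> set 'rV[R]_2) (f : 'rV[R]_2 -> 'rV[R]_3)
    (T : subgraph cube_adj) :
  unfolding K Q f -> edge_cutting_pattern K Q f T -> spanning_tree T.
Proof.
move=> unf [cutE cutV].
have [fc [P [h [[fi fcK fiK] QE dev]]]] := unfolding_development unf.
have [_ _ _ [chain single] fold] := unf.
have netE : arrangement_union Q = net P.
  apply/seteqP; split=> p [i _ ip]; first by exists (fc i); rewrite // -QE.
  by exists (fi i) => //; rewrite QE fiK.
rewrite netE in cutE single; have cont := fold_continuous fold.
have covered := vertex_cut dev cutE.
have VT : sg_vertices T = [set: cube_vertex]%SET.
  apply/setP => x; rewrite inE; apply/cutV.
  have [k kT] := covered x; exists [set x; flip x k]%SET => //.
  by rewrite !inE eqxx.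
have conT : sg_connected T.
  move=> x y _ _; apply: (cut_connected dev cutE).
  apply: connected_continuous_connected.
    exact: single_component_connected.
  apply: continuous_subspaceW cont => b /(boundary_net dev)[].
  by rewrite netE.
split=> //; apply: tight_connected_acyclic => //.
rewrite card_ffun card_ord card_bool.
exact: (cut_edges_bound dev (can_inj fcK) QE chain cutE).
Qed.
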